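(* Consider the semi-discrete path-conservative discontinuous Galerkin method for the one-dimensional two-layer shallow water equations, formulated in the equilibrium variables $\boldsymbol v=(E_1,m_1,E_2,m_2,b)^T$: find $\boldsymbol v\in\boldsymbol{\mathcal V}_h^k$ such that for every cell $\mathcal I_j$ and every test function $\boldsymbol\varphi\in\boldsymbol{\mathcal V}_h^k$ $$\frac{d}{dt}\int_{\mathcal I_j}\boldsymbol u(\boldsymbol v)\cdot\boldsymbol\varphi\,dx=\mathrm{RHS}^M_j(\boldsymbol v,\boldsymbol\varphi),$$ where the spatial operator $\mathrm{RHS}^M_j$, with its specially modified Lax–Friedrichs numerical flux and its path-integral term, is defined in the context. This method is exact for the one-dimensional moving water equilibrium state $$E_1=\text{constant},\quad m_1=\text{constant},\quad E_2=\text{constant},\quad m_2=\text{constant};$$ that is, if the data are in an exact moving water equilibrium state, then $\mathrm{RHS}^M_j(\boldsymbol v,\boldsymbol\varphi)=0$ for all $j$ and all $\boldsymbol\varphi\in\boldsymbol{\mathcal V}_h^k$.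
   Context: **Equations and variables.** $g$ is the gravitational acceleration and $r<1$ the density ratio of the upper layer (index 1) to the lower layer (index 2). $h_i$ are the layer thicknesses, $u_i$ the depth-averaged velocities, $m_i=h_iu_i$ the discharges, and $b$ the bottom topography. With the added trivial equation $b_t=0$, the conservative variables are $\boldsymbol u=(h_1,m_1,h_2,m_2,b)^T$ and the two-layer shallow water system is $\boldsymbol u_t+\boldsymbol f(\boldsymbol u)_x+\mathcal G(\boldsymbol u)\boldsymbol u_x=0$, where $$\boldsymbol f(\boldsymbol u)=\Big(m_1,\ \tfrac{m_1^2}{h_1}+\tfrac12gh_1^2,\ m_2,\ \tfrac{m_2^2}{h_2}+\tfrac12gh_2^2,\ 0\Big)^T$$ and $\mathcal G(\boldsymbol u)$ is the $5\times5$ matrix whose only nonzero entries are $\mathcal G_{23}=\mathcal G_{25}=gh_1$, $\mathcal G_{41}=grh_2$, $\mathcal G_{45}=gh_2$. The energies are $$E_1=\tfrac12u_1^2+g(h_1+h_2+b),\qquad E_2=\tfrac12u_2^2+g(rh_1+h_2+b).$$ Put $\boldsymbol v=(E_1,m_1,E_2,m_2,b)^T$ and $\widetilde{\boldsymbol v}=(E_1,m_1,E_2,m_2,0)^T$. Then $\boldsymbol f(\boldsymbol u)_x+\mathcal G(\boldsymbol u)\boldsymbol u_x=\mathcal L(\boldsymbol u)\widetilde{\boldsymbol v}(\boldsymbol u)_x$ with $$\mathcal L(\boldsymbol u)=\begin{pmatrix}0&1&0&0&0\\ h_1&u_1&0&0&0\\ 0&0&0&1&0\\ 0&0&h_2&u_2&0\\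 0&0&0&0&1\end{pmatrix}.$$ **Inverse transform.** $\boldsymbol u(\boldsymbol v)$ denotes the inverse of the transform $\boldsymbol u\mapsto\boldsymbol v$: $m_1,m_2,b$ are unchanged, and $(h_1,h_2)$ is obtained from $$Q_1=gh_1^3+(g(h_2+b)-E_1)h_1^2+\tfrac12m_1^2=0,\qquad Q_2=gh_2^3+(g(rh_1+b)-E_2)h_2^2+\tfrac12m_2^2=0,$$ solved in general by Newton iteration. **Mesh and spaces.** The domain is divided into cells $\mathcal I_j=[x_{j-\frac12},x_{j+\frac12}]$, $j=1,\dots,nx$. $\mathcal W_h^k$ is the space of functions that are polynomials of degree at most $k$ on each cell, and $\boldsymbol{\mathcal V}_h^k$ is the space of 5-component vectors with components in $\mathcal W_h^k$. The superscripts $-,+$ denote left and right limits at an interface, and $\boldsymbol u^\pm_{j+\frac12}=\boldsymbol u(\boldsymbol v^\pm_{j+\frac12})$. **Spatial operator.** $$\begin{aligned}\mathrm{RHS}^M_j(\boldsymbol v,\boldsymbol\varphi)=&\int_{\mathcal I_j}\boldsymbol f(\boldsymbol u(\boldsymbol v))\cdot\boldsymbol\varphi_x\,dx-\widehat{\boldsymbol f}^{\rm mod}_{j+\frac12}\cdot\boldsymbol\varphi^-_{j+\frac12}+\widehat{\boldsymbol f}^{\rm mod}_{j-\frac12}\cdot\boldsymbol\varphi^+_{j-\frac12}\\ &-\int_{\mathcal I_j}\mathcal G(\boldsymbol u(\boldsymbol v))\,\boldsymbol u(\boldsymbol v)_x\cdot\boldsymbol\varphi\,dx-\tfrac12\boldsymbol\varphi^-_{j+\frac12}\cdot\boldsymbol{\mathfrak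 g}_{j+\frac12}-\tfrac12\boldsymbol\varphi^+_{j-\frac12}\cdot\boldsymbol{\mathfrak g}_{j-\frac12}.\end{aligned}$$ In the cell integral of the nonconservative product, $\boldsymbol u(\boldsymbol v)_x$ is evaluated by the chain rule, with the derivatives of $h_1,h_2$ with respect to $\boldsymbol v$ obtained from $Q_1=Q_2=0$ by the implicit function theorem. *Modified flux:* $$\widehat{\boldsymbol f}^{\rm mod}_{j+\frac12}=\tfrac12\big(\boldsymbol f(\boldsymbol u^-_{j+\frac12})+\boldsymbol f(\boldsymbol u^+_{j+\frac12})\big)-\tfrac\alpha2\big(\boldsymbol u^{*,+}_{j+\frac12}-\boldsymbol u^{*,-}_{j+\frac12}\big),$$ where $\alpha$ is the maximum over $\boldsymbol u$ of the absolute values of the eigenvalues of $\partial\boldsymbol f/\partial\boldsymbol u$, $b^*_{j+\frac12}=\min(b^-_{j+\frac12},b^+_{j+\frac12})$, and $\boldsymbol u^{*,\pm}_{j+\frac12}=\big((h_1)^{*,\pm}_{j+\frac12},(m_1)^\pm_{j+\frac12},(h_2)^{*,\pm}_{j+\frac12},(m_2)^\pm_{j+\frac12},b^*_{j+\frac12}\big)^T$, with $(h_1)^{*,\pm},(h_2)^{*,\pm}$ solving (index $j+\frac12$ omitted) $$E_1^\pm=\frac{(m_1^\pm)^2}{2(h_1^{*,\pm})^2}+g(h_1^{*,\pm}+h_2^{*,\pm}+b^* ),\qquad E_2^\pm=\frac{(m_2^\pm)^2}{2(h_2^{*,\pm})^2}+g(rh_1^{*,\pm}+h_2^{*,\pm}+b^*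 ).$$ *Path-integral term:* $$\boldsymbol{\mathfrak g}_{j+\frac12}=\int_0^1\mathcal L(\boldsymbol\phi_{j+\frac12}(\tau))\,\frac{\partial}{\partial\tau}\widetilde{\boldsymbol v}(\boldsymbol\phi_{j+\frac12}(\tau))\,d\tau-\boldsymbol f(\boldsymbol u^+_{j+\frac12})+\boldsymbol f(\boldsymbol u^-_{j+\frac12}),$$ where the left and right states are connected by the linear segment path applied to the equilibrium functions, $\boldsymbol\phi_{j+\frac12}(\tau)=\widetilde{\boldsymbol v}^-_{j+\frac12}+\tau(\widetilde{\boldsymbol v}^+_{j+\frac12}-\widetilde{\boldsymbol v}^-_{j+\frac12})$. The integral thus becomes $\int_0^1\mathcal L(\boldsymbol\phi_{j+\frac12}(\tau))(\widetilde{\boldsymbol v}^+_{j+\frac12}-\widetilde{\boldsymbol v}^-_{j+\frac12})\,d\tau$, which is evaluated numerically, e.g. by Simpson's formula. *)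

(* Defs.v *)
From HB Require Import structures.
From mathcomp Require Import all_boot all_order all_algebra.
From mathcomp Require Import all_classical all_reals all_analysis.
Set Implicit Arguments.
Unset Strict Implicit.
Unset Printing Implicit Defensive.
Import Order.TTheory GRing.Theory Num.Theory.
Import numFieldNormedType.Exports.
Local Open Scope classical_set_scope.
Local Open Scope ring_scope.

Section TwoLayerShallowWater.
Context {R : realType}.

Definition vec5 (a0 a1 a2 a3 a4 : R) : 'rV[R]_5 :=
  \row_j [:: a0; a1; a2; a3; a4]`_j.

Definition dot (a c : 'rV[R]_5) : R := \sum_i a 0 i * c 0 i.

Variables (g r : R).

(* Conservative states are rows u = (h1, m1, h2, m2, b). *)

Definition flux (u : 'rV[R]_5) : 'rV[R]_5 :=
  let: h1 := u 0 0 in let: m1 := u 0 1 in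
  let: h2 := u 0 2 in let: m2 := u 0 3 in
  vec5 m1 (m1 ^+ 2 / h1 + g * h1 ^+ 2 / 2)
       m2 (m2 ^+ 2 / h2 + g * h2 ^+ 2 / 2) 0.

Definition Gmx (u : 'rV[R]_5) : 'M[R]_5 :=
  let: h1 := u 0 0 in let: h2 := u 0 2 in
  \matrix_(i, j) (nth [::]
    [:: [:: 0; 0; 0; 0; 0];
        [:: 0; 0; g * h1; 0; g * h1];
        [:: 0; 0; 0; 0; 0];
        [:: g * r * h2; 0; 0; 0; g * h2];
        [:: 0; 0; 0; 0; 0]] i)`_j.

Definition Lmx (u : 'rV[R]_5) : 'M[R]_5 :=
  let: h1 := u 0 0 in let: u1 := u 0 1 / h1 in
  let: h2 := u 0 2 in let: u2 := u 0 3 / h2 in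
  \matrix_(i, j) (nth [::]
    [:: [:: 0; 1; 0; 0; 0];
        [:: h1; u1; 0; 0; 0];
        [:: 0; 0; 0; 1; 0];
        [:: 0; 0; h2; u2; 0];
        [:: 0; 0; 0; 0; 1]] i)`_j.

(* The transform u |-> v = (E1, m1, E2, m2, b). *)
Definition equil (u : 'rV[R]_5) : 'rV[R]_5 :=
  let: h1 := u 0 0 in let: m1 := u 0 1 in
  let: h2 := u 0 2 in let: m2 := u 0 3 in let: b := u 0 4 in
  vec5 ((m1 / h1) ^+ 2 / 2 + g * (h1 + h2 + b)) m1
       ((m2 / h2) ^+ 2 / 2 + g * (r * h1 + h2 + b)) m2 b.

Definition tilde (v : 'rV[R]_5) : 'rV[R]_5 :=
  vec5 (v 0 0) (v 0 1) (v 0 2) (v 0 3) 0.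

Definition set_b (v : 'rV[R]_5) (b : R) : 'rV[R]_5 :=
  vec5 (v 0 0) (v 0 1) (v 0 2) (v 0 3) b.

(* (Q1, Q2) as a function of h = (h1, h2) and v = (E1, m1, E2, m2, b). *)
Definition Qfun (h : 'rV[R]_2) (v : 'rV[R]_5) : 'rV[R]_2 :=
  let: h1 := h 0 0 in let: h2 := h 0 1 in
  let: E1 := v 0 0 in let: m1 := v 0 1 in
  let: E2 := v 0 2 in let: m2 := v 0 3 in let: b := v 0 4 in
  \row_i [:: g * h1 ^+ 3 + (g * (h2 + b) - E1) * h1 ^+ 2 + m1 ^+ 2 / 2;
             g * h2 ^+ 3 + (g * (r * h1 + b) - E2) * h2 ^+ 2 + m2 ^+ 2 / 2]`_i.

Definition depths (u : 'rV[R]_5) : 'rV[R]_2 := \row_i [:: u 0 0; u 0 2]`_i.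

(* Q1 = Q2 = 0 has several roots (h1, h2) in general, so the inverse transform
   only makes sense on a regime D of conservative states on which the transform
   is one-to-one.  The last condition is the nondegeneracy required by the
   implicit function theorem for Q1 = Q2 = 0. *)
Definition flow_regime (D : set 'rV[R]_5) : Prop :=
  [/\ open D,
      forall u, D u -> 0 < u 0 0 /\ 0 < u 0 2,
      set_inj D equil &
      forall u, D u ->
        'J (fun h => Qfun h (equil u)) (depths u) \in unitmx].

Variable D : set 'rV[R]_5.

(* The inverse transform u(v); junk outside the image of D. *)
Definition inv_equil (v : 'rV[R]_5) : 'rV[R]_5 := pinv D equil v.

(* d(h1, h2)/dv given by the implicit function theorem for Q(h(v), v) = 0.
   'J follows the row convention  d f p w = w *m 'J f p. *)
Definition dh_dv (v : 'rV[R]_5) : 'M[R]_(5, 2) :=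
  let: h := depths (inv_equil v) in
  - ('J (Qfun h) v *m invmx ('J (fun h' => Qfun h' v) h)).

(* u(v)_x by the chain rule, from v and v_x. *)
Definition u_x (v vx : 'rV[R]_5) : 'rV[R]_5 :=
  let: hx := vx *m dh_dv v in
  vec5 (hx 0 0) (vx 0 1) (hx 0 1) (vx 0 3) (vx 0 4).

Section Scheme.
Variable nx : nat.

(* Interfaces x_{1/2} < ... < x_{nx+1/2} are numbered by 'I_nx.+1; cell
   j : 'I_nx lies between the interfaces ifl j and ifr j. *)
Definition ifl (j : 'I_nx) : 'I_nx.+1 := lift ord_max j.
Definition ifr (j : 'I_nx) : 'I_nx.+1 := lift ord0 j.

Variable xi : 'I_nx.+1 -> R.

Definition is_mesh : Prop := forall j, xi (ifl j) < xi (ifr j).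

Definition cell (j : 'I_nx) : set R := `[xi (ifl j), xi (ifr j)].

(* A piecewise polynomial 5-vector is given by its polynomials on the cells, so
   that one-sided limits at an interface are values of these polynomials. *)
Definition pwpoly := 'I_nx -> 'rV[{poly R}]_5.

Definition DGspace (k : nat) : set pwpoly :=
  [set w : pwpoly | forall j i, (size (w j ord0 i) <= k.+1)%N].

Definition ev (w : pwpoly) (j : 'I_nx) (x : R) : 'rV[R]_5 :=
  \row_i (w j 0 i).[x].

Definition ev_x (w : pwpoly) (j : 'I_nx) (x : R) : 'rV[R]_5 :=
  \row_i ((w j 0 i)^`()).[x].

(* The solution data: v on the cells, and the exterior traces vL at x_{1/2}
   and vR at x_{nx+1/2} prescribed by the boundary conditions. *)
Variables (v : pwpoly) (vL vR : 'rV[R]_5).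

Definition trace_minus (i : 'I_nx.+1) : 'rV[R]_5 :=
  if unlift ord0 i is Some j then ev v j (xi i) else vL.

Definition trace_plus (i : 'I_nx.+1) : 'rV[R]_5 :=
  if unlift ord_max i is Some j then ev v j (xi i) else vR.

(* All values taken by the data, including one-sided limits at interfaces. *)
Definition data_values : set 'rV[R]_5 :=
  [set w | (exists j x, cell j x /\ w = ev v j x) \/ w = vL \/ w = vR].

Definition admissible_data : Prop := data_values `<=` equil @` D.

Definition moving_water_equilibrium : Prop :=
  exists E1 m1 E2 m2 : R, forall w, data_values w ->
    [/\ w 0 0 = E1, w 0 1 = m1, w 0 2 = E2 & w 0 3 = m2].

(* Real eigenvalues suffice: those of 'J flux are 0 and u_i +- sqrt (g h_i). *)
Definition alpha : R :=
  sup [set a | exists w l, [/\ data_values w,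
                 eigenvalue ('J flux (inv_equil w)) l & a = `|l|]].

Definition b_star (i : 'I_nx.+1) : R :=
  Num.min (trace_minus i 0 4) (trace_plus i 0 4).

(* u^{*,+-} from a trace w = v^{+-}: the energies and discharges of w with the
   bottom b*; the depths solving the energy equations are the ones selected by
   the inverse transform. *)
Definition u_star (w : 'rV[R]_5) (bs : R) : 'rV[R]_5 :=
  let: us := inv_equil (set_b w bs) in
  vec5 (us 0 0) (w 0 1) (us 0 2) (w 0 3) bs.

Definition fmod (i : 'I_nx.+1) : 'rV[R]_5 :=
  2^-1 *: (flux (inv_equil (trace_minus i)) + flux (inv_equil (trace_plus i)))
  - (alpha / 2) *: (u_star (trace_plus i) (b_star i)
                    - u_star (trace_minus i) (b_star i)).

(* The linear segment path in the equilibrium functions. *)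
Definition path_tilde (i : 'I_nx.+1) (tau : R) : 'rV[R]_5 :=
  tilde (trace_minus i)
  + tau *: (tilde (trace_plus i) - tilde (trace_minus i)).

(* The conservative state on the path at which Lmx is evaluated: energies and
   discharges are those of path_tilde.  As path_tilde does not carry the
   bottom, b is interpolated linearly, so that the path joins u^- to u^+. *)
Definition path_state (i : 'I_nx.+1) (tau : R) : 'rV[R]_5 :=
  let: bm := trace_minus i 0 4 in let: bp := trace_plus i 0 4 in
  inv_equil (set_b (path_tilde i tau) (bm + tau * (bp - bm))).

Definition gpath (i : 'I_nx.+1) : 'rV[R]_5 :=
  \row_n (\int[lebesgue_measure]_(tau in `[0, 1])
     (derive1 (path_tilde i) tau *m (Lmx (path_state i tau))^T) 0 n)
  - flux (inv_equil (trace_plus i)) + flux (inv_equil (trace_minus i)).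

(* A matrix A acts on a row w, read as a column, by w |-> w *m A^T. *)
Definition RHSM (j : 'I_nx) (phi : pwpoly) : R :=
  let: phiR := ev phi j (xi (ifr j)) in
  let: phiL := ev phi j (xi (ifl j)) in
  (\int[lebesgue_measure]_(x in cell j)
     dot (flux (inv_equil (ev v j x))) (ev_x phi j x))
  - dot (fmod (ifr j)) phiR
  + dot (fmod (ifl j)) phiL
  - (\int[lebesgue_measure]_(x in cell j)
     dot (u_x (ev v j x) (ev_x v j x) *m (Gmx (inv_equil (ev v j x)))^T)
         (ev phi j x))
  - 2^-1 * dot phiR (gpath (ifr j))
  - 2^-1 * dot phiL (gpath (ifl j)).

End Scheme.
End TwoLayerShallowWater.

(* Main.v *)
Require Import Defs.
From mathcomp Require Import all_boot all_order all_algebra.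
From mathcomp Require Import all_classical all_reals all_analysis.
From mathcomp Require Import ring.
Import Order.TTheory GRing.Theory Num.Theory.
Import numFieldNormedType.Exports.
Local Open Scope classical_set_scope.
Local Open Scope ring_scope.

(** At a moving water equilibrium the data differ from a fixed vector
    (E1, m1, E2, m2) only in the bottom b.  Three things then happen.

    At an interface, the two modified states u^{*,-} and u^{*,+} are computed
    from the same energies, discharges and bottom b^*, so the dissipation term
    of the flux vanishes ([fmod_equilibrium]); the path in the equilibrium
    functions is constant, so its integral vanishes and only the jump of f
    remains ([gpath_equilibrium]).  Average plus half a jump is a one-sided
    value, and the interface terms reduce to f(u) . phi at the two ends of the
    cell, taken from inside.

    Inside a cell, v is the curve (E1, m1, E2, m2, b(x)), and
    f(u)_x + G(u) u_x = 0 along it, because both energies are constant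
    ([is_derive_flux]).  Hence f . phi_x - G u_x . phi is the derivative of
    f . phi, and the fundamental theorem of calculus cancels the cell integrals
    against the interface terms ([cell_balance]).

    The analytic point is that u(v) really is differentiable along the curve.
    The regime D only provides an injective transform on an open set with
    nonsingular Jacobian, so the regularity of the inverse has to be
    established.  The first energy equation gives h2 explicitly in terms of h1
    and b, which leaves one scalar equation in h1; its derivative in h1 is a
    nonzero multiple of the Jacobian, so it changes sign at the root, and the
    intermediate value theorem yields a root near the old one for every nearby
    b ([equil_surj_near]).  As D is open this root stays in D, and injectivity
    identifies it with the inverse transform, which is therefore continuous
    ([state_continuous]).  The energy equations have exact difference quotients,
    so Cramer's rule expresses the increments of the depths as continuous
    functions times the increment of b; continuity thus upgrades to
    differentiability, with the derivative predicted by the implicit function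
    theorem ([is_derive_depths], [dh_dv_bottom]). *)

Set Implicit Arguments.
Unset Strict Implicit.
Unset Printing Implicit Defensive.

(** * Calculus of row-valued functions and Jacobians *)

Section Rows.
Context {R : realType}.

Lemma differentiable_row (V : normedModType R) n (f : V -> 'rV[R]_n) a :
  (forall j, differentiable (fun x => f x 0 j) a) -> differentiable f a.
Proof.
move=> df; rewrite (_ : f = \sum_j (fun x => f x 0 j *: delta_mx 0 j)).
  by apply: differentiable_sum => j; apply: differentiableZl.
by apply/funext => x; rewrite fct_sumE [LHS]row_sum_delta.
Qed.

Lemma is_derive_coord n (p w : 'rV[R]_n) (j : 'I_n) :
  is_derive p w (fun h : 'rV[R]_n => h 0 j) (w 0 j).
Proof.
have did : derivable (@id 'rV[R]_n) p w by exact: derivable_id.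
apply: DeriveDef; first exact: (derivable_mxP _ _ _).1 did 0 j.
by rewrite -[in RHS](derive_id p w) (derive_mx did) mxE.
Qed.

Lemma mulmx_jacobian n m (f : 'rV[R]_n -> 'rV[R]_m) a w j :
  (forall j, differentiable (fun x => f x 0 j) a) ->
  (w *m 'J f a) 0 j = 'D_w (fun x => f x 0 j) a.
Proof.
move=> /differentiable_row df.
by rewrite -deriveEjacobian // derive_mx ?mxE//; apply: diff_derivable.
Qed.

Lemma vec5_coord a0 a1 a2 a3 a4 :
  let w := @vec5 R a0 a1 a2 a3 a4 in
  (w 0 0 = a0) * (w 0 1 = a1) * (w 0 2 = a2) * (w 0 3 = a3) * (w 0 4 = a4).
Proof. by rewrite /vec5 !mxE. Qed.

Lemma row5P (u w : 'rV[R]_5) :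
  u 0 0 = w 0 0 -> u 0 1 = w 0 1 -> u 0 2 = w 0 2 ->
  u 0 3 = w 0 3 -> u 0 4 = w 0 4 -> u = w.
Proof.
move=> h0 h1 h2 h3 h4; apply/rowP => -[[|[|[|[|[|//]]]]] lti].
- by rewrite (_ : Ordinal _ = 0)//; apply: val_inj.
- by rewrite (_ : Ordinal _ = 1)//; apply: val_inj.
- by rewrite (_ : Ordinal _ = 2)//; apply: val_inj.
- by rewrite (_ : Ordinal _ = 3)//; apply: val_inj.
- by rewrite (_ : Ordinal _ = 4)//; apply: val_inj.
Qed.

Lemma ord2P (P : 'I_2 -> Prop) : P 0 -> P 1 -> forall j, P j.
Proof.
move=> P0 P1 [[|[|//]] lti].
- by rewrite (_ : Ordinal _ = 0)//; apply: val_inj.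
- by rewrite (_ : Ordinal _ = 1)//; apply: val_inj.
Qed.

Lemma sum5 (f : 'I_5 -> R) : \sum_i f i = f 0 + f 1 + f 2 + f 3 + f 4.
Proof.
rewrite !big_ord_recr big_ord0 /= add0r.
by do !congr (_ + _); congr f; apply: val_inj.
Qed.

Lemma dotC (a c : 'rV[R]_5) : dot a c = dot c a.
Proof. by apply: eq_bigr => i _; rewrite mulrC. Qed.

Lemma dotDl (a b c : 'rV[R]_5) : dot (a + b) c = dot a c + dot b c.
Proof. by rewrite -big_split; apply: eq_bigr => i _; rewrite mxE mulrDl. Qed.

Lemma dotZl (t : R) (a c : 'rV[R]_5) : dot (t *: a) c = t * dot a c.
Proof. by rewrite mulr_sumr; apply: eq_bigr => i _; rewrite mxE mulrA. Qed.

Lemma dotNl (a c : 'rV[R]_5) : dot (- a) c = - dot a c.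
Proof. by rewrite -scaleN1r dotZl mulN1r. Qed.

End Rows.

Section RowLimits.
Context {R : realType} {T : Type} {F : set_system T} {FF : Filter F}.

Lemma cvg_row n (f : T -> 'rV[R]_n) (l : 'rV[R]_n) :
  (forall j, f x 0 j @[x --> F] --> l 0 j) -> f @ F --> l.
Proof.
move=> fl; rewrite (_ : f = fun x => \sum_j f x 0 j *: delta_mx 0 j); last first.
  by apply/funext => x; exact: row_sum_delta.
rewrite [l]row_sum_delta; apply: cvg_big => // [|j _].
- exact: add_continuous.
- exact: cvgZr_tmp.
Qed.

Lemma cvg_vec5 (f0 f1 f2 f3 f4 : T -> R) (a0 a1 a2 a3 a4 : R) :
  f0 @ F --> a0 -> f1 @ F --> a1 -> f2 @ F --> a2 -> f3 @ F --> a3 ->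
  f4 @ F --> a4 ->
  vec5 (f0 x) (f1 x) (f2 x) (f3 x) (f4 x) @[x --> F] --> vec5 a0 a1 a2 a3 a4.
Proof.
move=> c0 c1 c2 c3 c4; apply: cvg_row => -[[|[|[|[|[|//]]]]] lti].
all: by under eq_fun do rewrite mxE /=; rewrite mxE.
Qed.

Lemma cvg_dot (a c : T -> 'rV[R]_5) (a0 c0 : 'rV[R]_5) :
  (forall i, a x 0 i @[x --> F] --> a0 0 i) ->
  (forall i, c x 0 i @[x --> F] --> c0 0 i) ->
  dot (a x) (c x) @[x --> F] --> dot a0 c0.
Proof.
move=> ca cc; apply: cvg_big => // [|i _]; first exact: add_continuous.
exact: cvgM.
Qed.

Lemma cvgX (f : T -> R) (a : R) n :
  f @ F --> a -> f x ^+ n @[x --> F] --> a ^+ n.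
Proof. by move=> fa; exact: cvg_comp fa (@exprn_continuous R n a). Qed.

End RowLimits.

(** * Real-variable tools *)

Section RealTools.
Context {R : realType}.

Lemma is_derive1_caratheodory_near (f q : R -> R) (x : R) :
  (\forall z \near x, f z - f x = q z * (z - x)) -> {for x, continuous q} ->
  is_derive x 1 f (q x).
Proof.
move=> fq cq.
have : is_derive x 1 (fun z => f x + q z * (z - x)) (q x).
  apply/is_derive1_caratheodory; exists q; split => // z.
  by rewrite subrr mulr0 addr0 addrAC subrr add0r.
apply: near_eq_is_derive.
by apply: filterS fq => z <-; rewrite addrC subrK.
Qed.

(** Existence part of the implicit function theorem in one unknown.  The
    derivative in x is required at the base point only: it makes F change sign
    between x0 - t and x0 + t, the signs at these two points persist for nearby
    y by continuity, and the intermediate value theorem applies. *)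
Lemma implicit_zero (F : R -> R -> R) (x0 y0 a e : R) :
  0 < e -> F x0 y0 = 0 -> is_derive x0 1 (F ^~ y0) a -> a != 0 ->
  (forall x, `|x - x0| < e -> {for y0, continuous (F x)}) ->
  (\forall y \near y0, forall x, `|x - x0| < e -> {for x, continuous (F ^~ y)}) ->
  \forall y \near y0, exists2 x, `|x - x0| < e & F x y = 0.
Proof.
move=> e0 F0 /is_derive1_caratheodory[q [Fq cq qa]] a0 cFy cFx.
(* Multiplying by a treats both signs of the derivative at once. *)
have : \forall x \near x0, 0 < a * q x.
  have : {for x0, continuous (fun x => a * q x)}.
    by apply: cvgM => //; exact: cvg_cst.
  move=> /cvgr_gt; apply.
  by rewrite qa -expr2 exprn_even_gt0.
case/nbhs_ballP => d /= d0 dq.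
pose t := Num.min d e / 2.
have m0 : 0 < Num.min d e by rewrite lt_min d0 e0.
have t0 : 0 < t by rewrite divr_gt0.
have : t < Num.min d e by rewrite ltr_pdivrMr// ltr_pMr// ltr1n.
rewrite lt_min => /andP[td te].
have sgn s : `|s| = t -> 0 < a * q (x0 + s).
  by move=> st; apply: dq; rewrite /ball/= opprD addNKr normrN st.
have Fs s : F (x0 + s) y0 = q (x0 + s) * s.
  by move: (Fq (x0 + s)); rewrite F0 subr0 addrAC subrr add0r.
have close s : `|s| = t -> `|x0 + s - x0| < e.
  by move=> st; rewrite addrAC subrr add0r st.
have tt : `|t| = t by rewrite gtr0_norm.
have Nt : `|- t| = t by rewrite normrN.
have nearF s : `|s| = t -> \forall y \near y0, 0 < a * F (x0 + s) y * s.
  move=> st.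
  have c : {for y0, continuous (fun y => a * F (x0 + s) y * s)}.
    apply: cvgM; last exact: cvg_cst.
    by apply: cvgM; [exact: cvg_cst|exact: cFy (close _ st)].
  apply: (cvgr_gt _ c).
  rewrite Fs mulrA -mulrA pmulr_rgt0 ?sgn// -expr2 exprn_even_gt0//=.
  by rewrite -normr_eq0 st gt_eqF.
near=> y.
have Fp : 0 < a * F (x0 + t) y.
  by rewrite -(pmulr_lgt0 _ t0); near: y; exact: nearF.
have Fm : a * F (x0 - t) y < 0.
  by rewrite -oppr_gt0 -(pmulr_lgt0 _ t0) mulNr -mulrN; near: y; exact: nearF.
have cF : forall x, `|x - x0| < e -> {for x, continuous (F ^~ y)} by near: y.
have lt12 : x0 - t <= x0 + t by rewrite lerD2l ge0_cp// ltW.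
have cl x : x \in `[x0 - t, x0 + t] -> `|x - x0| < e.
  by rewrite in_itv/= -ler_distl => /le_lt_trans; apply.
have [||x xI ax] := @IVT _ (fun x => a * F x y) (x0 - t) (x0 + t) 0 lt12.
- apply: continuous_in_subspaceT => x; rewrite inE => /cl xe.
  by apply: cvgM; [exact: cvg_cst|exact: cF].
- by rewrite ge_min le_max (ltW Fp) (ltW Fm) orbT.
- exists x; first exact: cl.
  by move/eqP: ax; rewrite mulf_eq0 (negbTE a0) => /eqP.
Unshelve. all: by end_near. Qed.

Lemma poly_const_on_segment (p : {poly R}) (a b c : R) : a < b ->
  (forall x, x \in `[a, b] -> p.[x] = c) -> p = c%:P.
Proof.
move=> ab pc; apply/eqP; rewrite -subr_eq0; apply/eqP/eqP; apply: contraT => q0.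
set q := p - _ in q0.
(* The distinct points a + (b - a) / n are too many roots for p - c. *)
pose s := [seq a + (b - a) / i.+1%:R | i <- iota 0 (size q)].
have : (size s < size q)%N.
  apply: max_poly_roots => //.
  - apply/allP => _ /mapP[i _ ->]; rewrite /root /q !hornerE pc ?subrr// in_itv/=.
    have ba : 0 <= b - a by rewrite subr_ge0 ltW.
    rewrite lerDl divr_ge0//= -[leRHS](subrKC a) lerD2l.
    by rewrite ler_pdivrMr// ler_peMr// ler1n.
  - rewrite map_inj_uniq ?iota_uniq// => i j /addrI.
    have ba : b - a != 0 by rewrite subr_eq0 gt_eqF.
    by move=> /(mulfI ba)/invr_inj/eqP; rewrite eqr_nat => /eqP[].
by rewrite size_map size_iota ltnn.
Qed.

Lemma Rintegral_derive_split (a b : R) (F p q : R -> R) : a < b ->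
  (forall x, x \in `[a, b] -> is_derive x 1 F (p x - q x)) ->
  {within `[a, b], continuous p} -> {within `[a, b], continuous q} ->
  \int[lebesgue_measure]_(x in `[a, b]) p x
  - \int[lebesgue_measure]_(x in `[a, b]) q x = F b - F a.
Proof.
move=> ab dF cp cq.
have cF x : x \in `[a, b] -> {for x, continuous F}.
  by move=> /dF [Fx _]; apply: differentiable_continuous; exact/derivable1_diffP.
rewrite -RintegralB//; first last.
- by apply: continuous_compact_integrable => //; exact: segment_compact.
- by apply: continuous_compact_integrable => //; exact: segment_compact.
rewrite /Rintegral (@continuous_FTC2 _ _ F)//.
- by move=> x; apply: cvgB; [exact: cp|exact: cq].
- split.
  + by move=> x /subset_itv_oo_cc /dF [].
  + by apply: cvg_at_right_filter; apply: cF; rewrite in_itv/= lexx ltW.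
  + by apply: cvg_at_left_filter; apply: cF; rewrite in_itv/= lexx ltW.
- by move=> x /subset_itv_oo_cc /dF [_ <-]; rewrite derive1E.
Qed.

End RealTools.

(** * The Jacobians of the depth equations *)

Section DepthEquations.
Context {R : realType}.
Variables (g r : R).

Lemma depthsE (u : 'rV[R]_5) : (depths u 0 0 = u 0 0) * (depths u 0 1 = u 0 2).
Proof. by rewrite /depths !mxE. Qed.

Lemma QfunE (h : 'rV[R]_2) (v : 'rV[R]_5) :
  (Qfun g r h v 0 0 = g * h 0 0 ^+ 3
     + (g * (h 0 1 + v 0 4) - v 0 0) * h 0 0 ^+ 2 + v 0 1 ^+ 2 / 2) *
  (Qfun g r h v 0 1 = g * h 0 1 ^+ 3
     + (g * (r * h 0 0 + v 0 4) - v 0 2) * h 0 1 ^+ 2 + v 0 3 ^+ 2 / 2).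
Proof. by rewrite /Qfun !mxE. Qed.

Local Ltac differentiable_polynomial :=
  repeat first [ exact: differentiable_coord | apply: differentiableD
    | apply: differentiableN | apply: differentiableM | apply: differentiableZ
    | apply: differentiableX | exact: differentiable_cst ].

Lemma Qfun_dh (h w : 'rV[R]_2) (v : 'rV[R]_5) :
  let J := w *m 'J (fun h => Qfun g r h v) h in
  (J 0 0 = (3 * g * h 0 0 ^+ 2 + 2 * (g * (h 0 1 + v 0 4) - v 0 0) * h 0 0)
             * w 0 0 + g * h 0 0 ^+ 2 * w 0 1) *
  (J 0 1 = g * r * h 0 1 ^+ 2 * w 0 0
     + (3 * g * h 0 1 ^+ 2 + 2 * (g * (r * h 0 0 + v 0 4) - v 0 2) * h 0 1)
         * w 0 1).
Proof.
pose X : 'rV[R]_2 -> R := fun h => h 0 0.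
pose Y : 'rV[R]_2 -> R := fun h => h 0 1.
have Q0 : (fun h => Qfun g r h v 0 0) =
    g *: X ^+ 3 + (g *: (Y + cst (v 0 4)) - cst (v 0 0)) * X ^+ 2
    + cst (v 0 1 ^+ 2 / 2).
  by apply/funext => p; rewrite QfunE.
have Q1 : (fun h => Qfun g r h v 0 1) =
    g *: Y ^+ 3 + (g *: (r *: X + cst (v 0 4)) - cst (v 0 2)) * Y ^+ 2
    + cst (v 0 3 ^+ 2 / 2).
  by apply/funext => p; rewrite QfunE.
have dX : is_derive h w X (w 0 0) by exact: is_derive_coord.
have dY : is_derive h w Y (w 0 1) by exact: is_derive_coord.
have dQ j : differentiable (fun x => Qfun g r x v 0 j) h.
  by move: j; apply: ord2P; rewrite ?Q0 ?Q1; differentiable_polynomial.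
split; rewrite (mulmx_jacobian _ _ dQ).
- rewrite Q0; have -> := @derive_val _ _ _ _ _ _ _ (is_deriveD
    (is_deriveD (is_deriveZ g (is_deriveX 3 dX))
       (is_deriveM
          (is_deriveB
             (is_deriveZ g (is_deriveD dY (is_derive_cst (v 0 4) h w)))
             (is_derive_cst (v 0 0) h w)) (is_deriveX 2 dX)))
    (is_derive_cst (v 0 1 ^+ 2 / 2) h w)).
  rewrite !fctE /X /Y /= /GRing.scale /= /GRing.scale /= /GRing.scale /=; ring.
- rewrite Q1; have -> := @derive_val _ _ _ _ _ _ _ (is_deriveD
    (is_deriveD (is_deriveZ g (is_deriveX 3 dY))
       (is_deriveM
          (is_deriveB
             (is_deriveZ g
                (is_deriveD (is_deriveZ r dX) (is_derive_cst (v 0 4) h w)))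
             (is_derive_cst (v 0 2) h w)) (is_deriveX 2 dY)))
    (is_derive_cst (v 0 3 ^+ 2 / 2) h w)).
  rewrite !fctE /X /Y /= /GRing.scale /= /GRing.scale /= /GRing.scale /=; ring.
Qed.

Lemma Qfun_dv (h : 'rV[R]_2) (v w : 'rV[R]_5) :
  let J := w *m 'J (Qfun g r h) v in
  (J 0 0 = (g * w 0 4 - w 0 0) * h 0 0 ^+ 2 + v 0 1 * w 0 1) *
  (J 0 1 = (g * w 0 4 - w 0 2) * h 0 1 ^+ 2 + v 0 3 * w 0 3).
Proof.
pose V i : 'rV[R]_5 -> R := fun v => v 0 i.
have dV i : is_derive v w (V i) (w 0 i) by exact: is_derive_coord.
have Q0 : (fun v => Qfun g r h v 0 0) =
    cst (g * h 0 0 ^+ 3 + g * h 0 1 * h 0 0 ^+ 2)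
    + h 0 0 ^+ 2 *: (g *: V 4 - V 0) + 2^-1 *: V 1 ^+ 2.
  apply/funext => p.
  by rewrite QfunE !fctE /V /GRing.scale /= /GRing.scale /=; ring.
have Q1 : (fun v => Qfun g r h v 0 1) =
    cst (g * h 0 1 ^+ 3 + g * r * h 0 0 * h 0 1 ^+ 2)
    + h 0 1 ^+ 2 *: (g *: V 4 - V 2) + 2^-1 *: V 3 ^+ 2.
  apply/funext => p.
  by rewrite QfunE !fctE /V /GRing.scale /= /GRing.scale /=; ring.
have dQ j : differentiable (fun v => Qfun g r h v 0 j) v.
  by move: j; apply: ord2P; rewrite ?Q0 ?Q1; differentiable_polynomial.
split; rewrite (mulmx_jacobian _ _ dQ).
- rewrite Q0; have -> := @derive_val _ _ _ _ _ _ _ (is_deriveD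
    (is_deriveD (is_derive_cst _ v w)
       (is_deriveZ (h 0 0 ^+ 2) (is_deriveB (is_deriveZ g (dV 4)) (dV 0))))
    (is_deriveZ 2^-1 (is_deriveX 2 (dV 1)))).
  by rewrite /V /= /GRing.scale /= /GRing.scale /= /GRing.scale /=; field.
- rewrite Q1; have -> := @derive_val _ _ _ _ _ _ _ (is_deriveD
    (is_deriveD (is_derive_cst _ v w)
       (is_deriveZ (h 0 1 ^+ 2) (is_deriveB (is_deriveZ g (dV 4)) (dV 2))))
    (is_deriveZ 2^-1 (is_deriveX 2 (dV 3)))).
  by rewrite /V /= /GRing.scale /= /GRing.scale /= /GRing.scale /=; field.
Qed.

End DepthEquations.

(** * Nondegeneracy of a flow regime *)

Section Regime.
Context {R : realType}.
Variables (g r : R) (D : set 'rV[R]_5).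
Hypotheses (g_gt0 : 0 < g) (regimeD : flow_regime g r D).

(** The partial derivative of E_i with respect to h_i at fixed discharge m. *)
Definition slope (m h : R) : R := g - m ^+ 2 / h ^+ 3.

(** The Jacobian determinant of (E1, E2) with respect to (h1, h2). *)
Definition jac (u : 'rV[R]_5) : R :=
  slope (u 0 1) (u 0 0) * slope (u 0 3) (u 0 2) - g ^+ 2 * r.

Lemma depth_gt0 u : D u -> 0 < u 0 0 /\ 0 < u 0 2.
Proof. by case: regimeD => _ + _ _; apply. Qed.

Lemma inv_equilK w : (equil g r @` D) w -> equil g r (inv_equil g r D w) = w.
Proof. by move=> Dw; apply: pinvK; rewrite inE. Qed.

Lemma inv_equil_regime w : (equil g r @` D) w -> D (inv_equil g r D w).
Proof.
case=> u Du <-; rewrite /inv_equil pinvKV ?inE//.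
by case: regimeD.
Qed.

Lemma equilK u : D u -> inv_equil g r D (equil g r u) = u.
Proof. by move=> Du; apply: pinvKV; rewrite ?inE//; case: regimeD. Qed.

(** Q_i is h_i^2 times the defect in the i-th energy equation; where the defect
    vanishes, the derivative of Q_i is h_i^2 times that of the energy. *)
Lemma Qfun_dh_equil u (w : 'rV[R]_2) : D u ->
  let J := w *m 'J (fun h => Qfun g r h (equil g r u)) (depths u) in
  (J 0 0 = u 0 0 ^+ 2 * (slope (u 0 1) (u 0 0) * w 0 0 + g * w 0 1)) *
  (J 0 1 = u 0 2 ^+ 2 * (g * r * w 0 0 + slope (u 0 3) (u 0 2) * w 0 1)).
Proof.
move=> Du; have [h1 h2] := depth_gt0 Du.
rewrite /= !Qfun_dh !depthsE /equil !vec5_coord /slope.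
by split; field; rewrite gt_eqF.
Qed.

Lemma jac_neq0 u : D u -> jac u != 0.
Proof.
move=> Du; apply/eqP => det0.
have [_ _ _ /(_ _ Du) unitJ] := regimeD.
have [h1 h2] := depth_gt0 Du.
(* This vector spans the kernel of the first energy's differential, and a zero
   determinant puts it in the kernel of the second one. *)
pose w : 'rV[R]_2 := \row_j [:: g; - slope (u 0 1) (u 0 0)]`_j.
have wJ : w *m 'J (fun h => Qfun g r h (equil g r u)) (depths u) = 0.
  apply/rowP; apply: ord2P; rewrite Qfun_dh_equil// !mxE /=; first by ring.
  transitivity (- u 0 2 ^+ 2 * jac u); first by rewrite /jac; ring.
  by rewrite det0 mulr0.
have := mulmxK unitJ w; rewrite wJ mul0mx => /rowP/(_ 0).
by rewrite !mxE /= => g0; move: g_gt0; rewrite -g0 ltxx.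
Qed.

(** The derivatives of h_1 and h_2 with respect to b at fixed energies and
    discharges, by Cramer's rule. *)
Definition dh1 (u : 'rV[R]_5) : R := - g * (slope (u 0 3) (u 0 2) - g) / jac u.
Definition dh2 (u : 'rV[R]_5) : R :=
  - g * (slope (u 0 1) (u 0 0) - g * r) / jac u.

Lemma dhP u : jac u != 0 ->
  (slope (u 0 1) (u 0 0) * dh1 u + g * dh2 u + g = 0) *
  (g * r * dh1 u + slope (u 0 3) (u 0 2) * dh2 u + g = 0).
Proof.
rewrite /dh1 /dh2 /jac; move: (slope _ _) (slope _ _) => s1 s2 d0.
by split; field.
Qed.

(** Multiplied by the Jacobian in h, the product with [dh_dv] becomes a linear
    system for the depth increments, whose solution is unique as [jac] does not
    vanish. *)
Lemma dh_dv_bottom w z : (equil g r @` D) w ->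
  let hx := vec5 0 0 0 0 z *m dh_dv g r D w in
  let u := inv_equil g r D w in
  (hx 0 0 = dh1 u * z) * (hx 0 1 = dh2 u * z).
Proof.
move=> Dw; set wx := vec5 _ _ _ _ _; set hx := _ *m _.
set u := inv_equil _ _ _ _.
have Du : D u by exact: inv_equil_regime.
have uw : equil g r u = w by exact: inv_equilK.
have [h1 h2] := depth_gt0 Du.
have [_ _ _ /(_ _ Du)] := regimeD; rewrite uw => unitJ.
have := jac_neq0 Du; set d := jac u => d0.
have e : hx *m 'J (fun h => Qfun g r h w) (depths u)
         = - (wx *m 'J (Qfun g r (depths u)) w).
  by rewrite /hx /dh_dv -/u mulmxN mulmxA mulNmx mulmxKV.
have e0 : u 0 0 ^+ 2
    * (slope (u 0 1) (u 0 0) * hx 0 0 + g * hx 0 1 + g * z) = 0.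
  move/rowP/(_ 0): e.
  rewrite -{1}uw (Qfun_dh_equil _ Du) [fun_of_matrix (- _) _ _]mxE Qfun_dv depthsE.
  by rewrite /wx !vec5_coord mulr0 addr0 subr0 => E; rewrite mulrDr E; ring.
have e1 : u 0 2 ^+ 2
    * (g * r * hx 0 0 + slope (u 0 3) (u 0 2) * hx 0 1 + g * z) = 0.
  move/rowP/(_ 1): e.
  rewrite -{1}uw (Qfun_dh_equil _ Du) [fun_of_matrix (- _) _ _]mxE Qfun_dv depthsE.
  by rewrite /wx !vec5_coord mulr0 addr0 subr0 => E; rewrite mulrDr E; ring.
move/eqP: e0; rewrite mulf_eq0 expf_eq0 gt_eqF//= => /eqP e0.
move/eqP: e1; rewrite mulf_eq0 expf_eq0 gt_eqF//= => /eqP e1.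
rewrite /dh1 /dh2 -/d.
split; apply: (mulIf d0); rewrite [RHS]mulrAC divfK// /d /jac; move: e0 e1;
  move: (slope _ _) (slope _ _) => s2 s1 e0 e1;
  apply/eqP; rewrite -subr_eq0; apply/eqP.
- by transitivity (s2 * (s1 * hx 0 0 + g * hx 0 1 + g * z)
     - g * (g * r * hx 0 0 + s2 * hx 0 1 + g * z)); [ring|rewrite e0 e1; ring].
- by transitivity (s1 * (g * r * hx 0 0 + s2 * hx 0 1 + g * z)
     - g * r * (s1 * hx 0 0 + g * hx 0 1 + g * z)); [ring|rewrite e0 e1; ring].
Qed.

End Regime.

(** * The inverse transform along a curve of varying bottom *)

Section Branch.
Context {R : realType}.
Variables (g r : R) (D : set 'rV[R]_5).
Hypotheses (g_gt0 : 0 < g) (regimeD : flow_regime g r D).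
Variables E1 m1 E2 m2 : R.

Notation curve := (vec5 E1 m1 E2 m2).
Notation state b := (inv_equil g r D (curve b)).

(** The second depth, as determined by the first depth, the bottom and the first
    energy equation; the second energy equation is left over as a single
    equation [defect h b = 0] for the first depth. *)
Let depth2 (h b : R) : R := (E1 - (m1 / h) ^+ 2 / 2) / g - h - b.
Let extend (h b : R) := vec5 h m1 (depth2 h b) m2 b.
Let defect (h b : R) : R :=
  (m2 / depth2 h b) ^+ 2 / 2 + g * (r * h + depth2 h b + b) - E2.

Lemma equil_extend h b : defect h b = 0 -> equil g r (extend h b) = curve b.
Proof.
move=> /eqP; rewrite subr_eq0 => /eqP res0.
rewrite /equil !vec5_coord res0; congr vec5.
by rewrite /depth2; move: (m1 / h) => u1; field; rewrite gt_eqF.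
Qed.

Section Limits.
Context {T : Type} {F : set_system T} {FF : Filter F}.
Variables (h b : T -> R) (h0 b0 : R).
Hypotheses (hh0 : h @ F --> h0) (bb0 : b @ F --> b0) (h0_neq0 : h0 != 0).

Lemma depth2_cvg : depth2 (h x) (b x) @[x --> F] --> depth2 h0 b0.
Proof.
apply: cvgB => //; apply: cvgB => //; apply: cvgMr_tmp; apply: cvgB.
- exact: cvg_cst.
- by apply: cvgMr_tmp; apply: cvgX; apply: cvgMl_tmp; exact: cvgV.
Qed.

Lemma extend_cvg : extend (h x) (b x) @[x --> F] --> extend h0 b0.
Proof.
by apply: cvg_vec5 => //; [exact: cvg_cst|exact: depth2_cvg|exact: cvg_cst].
Qed.

Lemma defect_cvg : depth2 h0 b0 != 0 ->
  defect (h x) (b x) @[x --> F] --> defect h0 b0.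
Proof.
move=> d0; apply: cvgB; last exact: cvg_cst.
apply: cvgD.
  apply: cvgMr_tmp; apply: cvgX; apply: cvgMl_tmp; apply: cvgV => //.
  exact: depth2_cvg.
apply: cvgMl_tmp; apply: cvgD => //; apply: cvgD; last exact: depth2_cvg.
exact: cvgMl_tmp.
Qed.

End Limits.

(** Multiplied by - g, this derivative is the Jacobian determinant [jac], hence
    it does not vanish on D. *)
Lemma is_derive_defect (h b : R) : h != 0 -> depth2 h b != 0 ->
  is_derive h 1 (defect ^~ b)
    (g * r - slope g m1 h * slope g m2 (depth2 h b) / g).
Proof.
move=> h0 d0.
have dd : is_derive h (1 : R) (depth2 ^~ b) (- slope g m1 h / g).
  have dV : is_derive h (1 : R) (fun y : R => y^-1) (- h ^- 2 *: 1) :=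
    is_deriveV h0 (is_derive_id h (1 : R)).
  have -> : depth2 ^~ b =
      cst (E1 / g - b) - (m1 ^+ 2 / 2 / g) *: (fun y : R => y^-1) ^+ 2 - id.
    apply/funext => y.
    by rewrite !fctE /depth2 /GRing.scale /= exprMn exprVn mulrBl; ring.
  apply: is_derive_eq (is_deriveB
    (is_deriveB (is_derive_cst _ _ _) (is_deriveZ _ (is_deriveX 2 dV)))
    (is_derive_id h (1 : R))) _.
  rewrite /slope /GRing.scale /= /GRing.scale /= mulr1; field.
  by rewrite h0 gt_eqF.
have dV := @is_deriveV R (depth2 ^~ b) _ _ _ d0 dd.
have -> : defect ^~ b = (m2 ^+ 2 / 2) *: (fun y => (depth2 y b)^-1) ^+ 2
    + g *: (r *: id + depth2 ^~ b + cst b) - cst E2.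
  apply/funext => y.
  by rewrite !fctE /defect /GRing.scale /= exprMn exprVn; ring.
apply: is_derive_eq (is_deriveB
  (is_deriveD (is_deriveZ _ (is_deriveX 2 dV))
     (is_deriveZ _ (is_deriveD
        (is_deriveD (is_deriveZ _ (is_derive_id h (1 : R))) dd)
        (is_derive_cst _ _ _))))
  (is_derive_cst _ _ _)) _.
rewrite /slope /GRing.scale /= /GRing.scale /= mulr1; field.
by rewrite h0 d0 gt_eqF.
Qed.

Lemma equil_coord u b : equil g r u = curve b ->
  [/\ u 0 1 = m1, u 0 3 = m2, u 0 4 = b,
      E1 = (m1 / u 0 0) ^+ 2 / 2 + g * (u 0 0 + u 0 2 + b) &
      E2 = (m2 / u 0 2) ^+ 2 / 2 + g * (r * u 0 0 + u 0 2 + b)].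
Proof.
move=> e.
have := congr1 (fun w : 'rV_5 => w 0 0) e.
have := congr1 (fun w : 'rV_5 => w 0 1) e.
have := congr1 (fun w : 'rV_5 => w 0 2) e.
have := congr1 (fun w : 'rV_5 => w 0 3) e.
have := congr1 (fun w : 'rV_5 => w 0 4) e.
by rewrite /equil !vec5_coord => -> -> <- -> <-.
Qed.

(** The transform is open along the curve: solving [defect h b = 0] by
    [implicit_zero] produces, for every bottom b near b0, a preimage of
    [curve b] as close to u0 as desired, hence inside the open set D. *)
Lemma equil_surj_near u0 (b0 : R) (W : set 'rV[R]_5) :
  D u0 -> equil g r u0 = curve b0 -> nbhs u0 W ->
  \forall b \near b0, exists u, [/\ W u, D u & equil g r u = curve b].
Proof.
move=> Du0 e0 Wu0; have [m1E m2E bE E1E E2E] := equil_coord e0.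
have [h1_gt0 h2_gt0] := depth_gt0 regimeD Du0.
set h0 := u0 0 0 in h1_gt0 E1E E2E.
have d2 : depth2 h0 b0 = u0 0 2.
  by rewrite /depth2 E1E; move: (m1 / h0) => u1; field; rewrite gt_eqF.
have u0E : extend h0 b0 = u0.
  by apply: row5P; rewrite /extend !vec5_coord.
have oD : nbhs u0 (W `&` D).
  apply: filterI => //; apply: open_nbhs_nbhs; split => //; by case: regimeD.
have : nbhs (h0, b0) (fun z => (W `&` D) (extend z.1 z.2)).
  suff : extend z.1 z.2 @[z --> (h0, b0)] --> u0 by apply.
  rewrite -u0E; apply: extend_cvg; [exact: cvg_fst|exact: cvg_snd|].
  by rewrite gt_eqF.
case/nbhs_ballP => e /= e_gt0 ball_e.
have box h b : `|h - h0| < e -> `|b - b0| < e -> (W `&` D) (extend h b).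
  by move=> he be; apply: (ball_e (h, b)); split; rewrite /ball/= distrC.
have pos h b : `|h - h0| < e -> `|b - b0| < e -> h != 0 /\ depth2 h b != 0.
  move=> he be; have [_ /(depth_gt0 regimeD)] := box _ _ he be.
  by rewrite /extend !vec5_coord => -[? ?]; rewrite !gt_eqF.
have b0e : `|b0 - b0| < e by rewrite subrr normr0.
have res0 : defect h0 b0 = 0 by rewrite /defect d2 -E2E subrr.
have near_e : \forall b \near b0, `|b - b0| < e.
  by apply/nbhs_ballP; exists e => //= b; rewrite /ball/= distrC.
have dres := is_derive_defect (lt0r_neq0 h1_gt0)
  (eq_ind_r (fun d => d != 0) (lt0r_neq0 h2_gt0) d2).
near=> b.
have be : `|b - b0| < e by near: b.
have [h he resh] : exists2 h, `|h - h0| < e & defect h b = 0.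
  near: b; apply: implicit_zero e_gt0 res0 dres _ _ _.
  - rewrite d2; have := jac_neq0 g_gt0 regimeD Du0.
    rewrite /jac m1E m2E; apply: contra_neq => dres0.
    transitivity (- g * (g * r - slope g m1 h0 * slope g m2 (u0 0 2) / g)).
      by field; rewrite gt_eqF.
    by rewrite dres0 mulr0.
  - move=> h he; have [h0' d0'] := pos _ _ he b0e.
    by apply: defect_cvg => //; exact: cvg_cst.
  - near=> b => h he; have [|h0' d0'] := pos h b he; first by near: b.
    by apply: defect_cvg => //; exact: cvg_cst.
have [Wu Du] := box _ _ he be.
by exists (extend h b); split => //; exact: equil_extend.
Unshelve. all: by end_near. Qed.

Lemma equil_image_near (b0 : R) : (equil g r @` D) (curve b0) ->
  \forall b \near b0, (equil g r @` D) (curve b).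
Proof.
case=> u0 Du0 e0.
have surj := equil_surj_near Du0 e0 (@filterT _ _ (nbhs_filter u0)).
by apply: filterS surj => b [u [_ Du e]]; exists u.
Qed.

(** The nearby preimage in D is the value of the inverse transform because the
    transform is injective on D. *)
Lemma state_continuous (b0 : R) : (equil g r @` D) (curve b0) ->
  {for b0, continuous (fun b => state b)}.
Proof.
case=> u0 Du0 e0 W; rewrite /= -e0 (equilK regimeD)// => Wu0.
have surj := equil_surj_near Du0 e0 Wu0.
by apply: filterS surj => b [u [Wu Du eb]] /=; rewrite -eb (equilK regimeD).
Qed.

Lemma depth_continuous (b0 : R) i : (equil g r @` D) (curve b0) ->
  {for b0, continuous (fun b => state b 0 i)}.
Proof.
move=> /state_continuous c.
exact: (continuous_comp c (@coord_continuous _ _ _ 0 i _)).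
Qed.

(** The difference quotient of the part of E_i that depends on h_i. *)
Definition secant (m h x : R) : R := g - m ^+ 2 / 2 * (x + h) / (x * h) ^+ 2.

Lemma secant_slope m h : h != 0 -> secant m h h = slope g m h.
Proof. by move=> h0; rewrite /secant /slope; field. Qed.

Lemma secantP m h x : x != 0 -> h != 0 ->
  secant m h x * (x - h)
  = ((m / x) ^+ 2 / 2 + g * x) - ((m / h) ^+ 2 / 2 + g * h).
Proof. by move=> x0 h0; rewrite /secant; field; rewrite x0 h0. Qed.

Lemma secant_continuous m h (f : R -> R) b0 : h != 0 -> f b0 != 0 ->
  {for b0, continuous f} -> {for b0, continuous (fun b => secant m h (f b))}.
Proof.
move=> h0 f0 c; apply: cvgB; first exact: cvg_cst.
apply: cvgM; first by apply: cvgMl_tmp; apply: cvgD; [exact: c|exact: cvg_cst].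
apply: cvgV; first by rewrite expf_neq0// mulf_neq0.
by apply: cvgX; apply: cvgMr_tmp; exact: c.
Qed.

(** Subtracting the energy equations at b and b0 gives a linear system for the
    depth increments with the [secant] coefficients in place of the [slope]
    ones; its determinant is continuous, and equal to [jac] at b0, so Cramer's
    rule provides Caratheodory slopes near b0. *)
Lemma is_derive_depths (b0 : R) : (equil g r @` D) (curve b0) ->
  is_derive b0 1 (fun b => state b 0 0) (dh1 g r (state b0)) /\
  is_derive b0 1 (fun b => state b 0 2) (dh2 g r (state b0)).
Proof.
move=> im0.
have Du0 := inv_equil_regime regimeD im0.
have [h1_gt0 h2_gt0] := depth_gt0 regimeD Du0.
have [m1E m2E _ E1E E2E] := equil_coord (inv_equilK im0).
set h1 := state b0 0 0 in h1_gt0 E1E E2E.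
set h2 := state b0 0 2 in h2_gt0 E1E E2E.
have h1_neq0 := lt0r_neq0 h1_gt0; have h2_neq0 := lt0r_neq0 h2_gt0.
pose S1 b := secant m1 h1 (state b 0 0); pose S2 b := secant m2 h2 (state b 0 2).
pose det b := S1 b * S2 b - g ^+ 2 * r.
have cS1 : {for b0, continuous S1}.
  by apply: secant_continuous => //; exact: depth_continuous im0.
have cS2 : {for b0, continuous S2}.
  by apply: secant_continuous => //; exact: depth_continuous im0.
have cdet : {for b0, continuous det}.
  by apply: cvgB; [exact: cvgM|exact: cvg_cst].
have S1E : S1 b0 = slope g (state b0 0 1) h1 by rewrite m1E /S1 secant_slope.
have S2E : S2 b0 = slope g (state b0 0 3) h2 by rewrite m2E /S2 secant_slope.
have detE : det b0 = jac g r (state b0) by rewrite /det S1E S2E.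
have det0 : det b0 != 0 by rewrite detE; exact: jac_neq0 Du0.
have incr : \forall b \near b0,
    det b * (state b 0 0 - h1) = - g * (S2 b - g) * (b - b0) /\
    det b * (state b 0 2 - h2) = - g * (S1 b - g * r) * (b - b0).
  apply: filterS (equil_image_near im0) => b im.
  have [/lt0r_neq0 k1 /lt0r_neq0 k2] :=
    depth_gt0 regimeD (inv_equil_regime regimeD im).
  have [_ _ _ E1E' E2E'] := equil_coord (inv_equilK im).
  have P1 : S1 b * (state b 0 0 - h1)
            = - g * (state b 0 2 - h2) - g * (b - b0).
    rewrite secantP//.
    have /eqP := etrans (esym E1E') E1E; rewrite -subr_eq0 => /eqP e.
    by apply/eqP; rewrite -subr_eq0; apply/eqP; rewrite -[RHS]e; ring.
  have P2 : S2 b * (state b 0 2 - h2)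
            = - g * r * (state b 0 0 - h1) - g * (b - b0).
    rewrite secantP//.
    have /eqP := etrans (esym E2E') E2E; rewrite -subr_eq0 => /eqP e.
    by apply/eqP; rewrite -subr_eq0; apply/eqP; rewrite -[RHS]e; ring.
  rewrite /det; split.
  - transitivity (S2 b * (S1 b * (state b 0 0 - h1))
                  - g ^+ 2 * r * (state b 0 0 - h1)); first ring.
    rewrite P1; transitivity (- g * (S2 b * (state b 0 2 - h2))
      - g * S2 b * (b - b0) - g ^+ 2 * r * (state b 0 0 - h1)); first ring.
    by rewrite P2; ring.
  - transitivity (S1 b * (S2 b * (state b 0 2 - h2))
                  - g ^+ 2 * r * (state b 0 2 - h2)); first ring.
    rewrite P2; transitivity (- g * r * (S1 b * (state b 0 0 - h1))
      - g * S1 b * (b - b0) - g ^+ 2 * r * (state b 0 2 - h2)); first ring.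
    by rewrite P1; ring.
have near0 : \forall b \near b0, det b != 0 by exact: cvgr_neq0 cdet det0.
split.
- have -> : dh1 g r (state b0) = - g * (S2 b0 - g) / det b0.
    by rewrite detE S2E.
  apply: (@is_derive1_caratheodory_near _ _ (fun b => - g * (S2 b - g) / det b)).
    apply: filterS2 near0 incr => b d0 [+ _].
    by rewrite -/h1 => e; apply: (mulfI d0); rewrite e; field.
  apply: cvgM; last exact: cvgV.
  by apply: cvgMl_tmp; apply: cvgB; [exact: cS2|exact: cvg_cst].
- have -> : dh2 g r (state b0) = - g * (S1 b0 - g * r) / det b0.
    by rewrite detE S1E.
  apply: (@is_derive1_caratheodory_near _ _
            (fun b => - g * (S1 b - g * r) / det b)).
    apply: filterS2 near0 incr => b d0 [_ +].
    by rewrite -/h2 => e; apply: (mulfI d0); rewrite e; field.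
  apply: cvgM; last exact: cvgV.
  by apply: cvgMl_tmp; apply: cvgB; [exact: cS1|exact: cvg_cst].
Qed.

End Branch.

(** * The balance of flux and nonconservative product *)

Section Balance.
Context {R : realType}.
Variables (g r : R) (D : set 'rV[R]_5).
Hypotheses (g_gt0 : 0 < g) (regimeD : flow_regime g r D).
Variables E1 m1 E2 m2 : R.
Notation curve := (vec5 E1 m1 E2 m2).
Notation state b := (inv_equil g r D (curve b)).

Lemma mulmx_Gmx (u w : 'rV[R]_5) : w *m (Gmx g r u)^T =
  vec5 0 (g * u 0 0 * (w 0 2 + w 0 4)) 0 (g * u 0 2 * (r * w 0 0 + w 0 4)) 0.
Proof. by apply: row5P; rewrite vec5_coord !mxE sum5 !mxE /=; ring. Qed.

(** The derivative of u(v) with respect to b at fixed energies and discharges. *)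
Definition du (u : 'rV[R]_5) : 'rV[R]_5 := vec5 (dh1 g r u) 0 (dh2 g r u) 0 1.
Notation Gdu u := (du u *m (Gmx g r u)^T).

Lemma slope_cvg (T : Type) (F : set_system T) {FF : Filter F}
    (m h : T -> R) (m0 h0 : R) :
  m @ F --> m0 -> h @ F --> h0 -> h0 != 0 ->
  slope g (m x) (h x) @[x --> F] --> slope g m0 h0.
Proof.
move=> mm hh h00; apply: cvgB; first exact: cvg_cst.
apply: cvgM; first exact: cvgX.
by apply: cvgV; [rewrite expf_neq0|exact: cvgX].
Qed.

Lemma Gdu_cvg (T : Type) (F : set_system T) {FF : Filter F}
    (u : T -> 'rV[R]_5) (u0 : 'rV[R]_5) :
  D u0 -> u @ F --> u0 -> Gdu (u x) @[x --> F] --> Gdu u0.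
Proof.
move=> Du0 uu0; have [h1_gt0 h2_gt0] := depth_gt0 regimeD Du0.
have c i : u x 0 i @[x --> F] --> u0 0 i.
  exact: cvg_comp uu0 (@coord_continuous _ _ _ 0 i u0).
have s1 : slope g (u x 0 1) (u x 0 0) @[x --> F] --> slope g (u0 0 1) (u0 0 0).
  by apply: slope_cvg => //; rewrite gt_eqF.
have s2 : slope g (u x 0 3) (u x 0 2) @[x --> F] --> slope g (u0 0 3) (u0 0 2).
  by apply: slope_cvg => //; rewrite gt_eqF.
have cj : (jac g r (u x))^-1 @[x --> F] --> (jac g r u0)^-1.
  apply: cvgV; first exact: (jac_neq0 g_gt0 regimeD Du0).
  by apply: cvgB; [exact: cvgM|exact: cvg_cst].
have cd1 : dh1 g r (u x) @[x --> F] --> dh1 g r u0.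
  by apply: cvgM => //; apply: cvgMl_tmp; apply: cvgB => //; exact: cvg_cst.
have cd2 : dh2 g r (u x) @[x --> F] --> dh2 g r u0.
  by apply: cvgM => //; apply: cvgMl_tmp; apply: cvgB => //; exact: cvg_cst.
rewrite mulmx_Gmx /du !vec5_coord.
under eq_fun do rewrite mulmx_Gmx /du !vec5_coord.
apply: cvg_vec5; try exact: cvg_cst.
- apply: cvgM; first exact: cvgMl_tmp.
  by apply: cvgD; [|exact: cvg_cst].
- apply: cvgM; first exact: cvgMl_tmp.
  by apply: cvgD; [exact: cvgMl_tmp|exact: cvg_cst].
Qed.

(** At constant discharge, the momentum flux of a layer changes h times as fast
    as its own part u^2 / 2 + g h of the energy. *)
Lemma is_derive_momentum (m b0 l : R) (h : R -> R) :
  h b0 != 0 -> is_derive b0 1 h l ->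
  is_derive b0 1 (fun b => m ^+ 2 / h b + g * h b ^+ 2 / 2)
    (h b0 * slope g m (h b0) * l).
Proof.
move=> h0 dh; have dV := is_deriveV h0 dh.
have -> : (fun b => m ^+ 2 / h b + g * h b ^+ 2 / 2) =
   m ^+ 2 *: (fun b => (h b)^-1) + (g / 2) *: h ^+ 2.
  by apply/funext => b; rewrite !fctE /GRing.scale /=; ring.
apply: is_derive_eq
  (is_deriveD (is_deriveZ _ dV) (is_deriveZ _ (is_deriveX 2 dh))) _.
by rewrite /slope /GRing.scale /= /GRing.scale /=; field.
Qed.

(** The steady equations f(u)_b + G(u) u_b = 0 along the curve: by
    [is_derive_momentum] the i-th momentum equation is h_i times the derivative
    of the i-th energy, which is constant. *)
Lemma is_derive_flux (b0 : R) i : (equil g r @` D) (curve b0) ->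
  is_derive b0 1 (fun b => flux g (state b) 0 i) (- Gdu (state b0) 0 i).
Proof.
move=> im0; have Du0 := inv_equil_regime regimeD im0.
have [h1_gt0 h2_gt0] := depth_gt0 regimeD Du0.
have [m1E m2E _ _ _] := equil_coord (inv_equilK im0).
have [d1 d2] := is_derive_depths g_gt0 regimeD im0.
have [e1 e2] := dhP (jac_neq0 g_gt0 regimeD Du0).
have d3 := is_derive_momentum m1 (lt0r_neq0 h1_gt0) d1.
have d4 := is_derive_momentum m2 (lt0r_neq0 h2_gt0) d2.
rewrite m1E in e1; rewrite m2E in e2.
pose f b := vec5 m1 (m1 ^+ 2 / state b 0 0 + g * state b 0 0 ^+ 2 / 2)
               m2 (m2 ^+ 2 / state b 0 2 + g * state b 0 2 ^+ 2 / 2) 0.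
have : is_derive b0 1 (fun b => f b 0 i) (- Gdu (state b0) 0 i).
  rewrite mulmx_Gmx /du !vec5_coord.
  case: i => -[|[|[|[|[|//]]]]] lti.
  all: under eq_fun do rewrite mxE /=; rewrite mxE /=.
  - by apply: is_derive_eq; rewrite oppr0.
  - apply: is_derive_eq d3 _; apply/eqP; rewrite -subr_eq0; apply/eqP.
    by rewrite -[RHS](mulr0 (state b0 0 0)) -e1; ring.
  - by apply: is_derive_eq; rewrite oppr0.
  - apply: is_derive_eq d4 _; apply/eqP; rewrite -subr_eq0; apply/eqP.
    by rewrite -[RHS](mulr0 (state b0 0 2)) -e2; ring.
  - by apply: is_derive_eq; rewrite oppr0.
(* The discharges of the inverse transform are constant only where the curve
   stays in the image of D, hence near b0. *)
apply: near_eq_is_derive.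
apply: filterS (equil_image_near g_gt0 regimeD im0) => b im.
have [bm1 bm2 _ _ _] := equil_coord (inv_equilK im).
by rewrite /flux bm1 bm2 mxE.
Qed.

End Balance.

(** * The scheme at an equilibrium *)

Section Interface.
Context {R : realType}.
Variables (g r : R) (D : set 'rV[R]_5) (nx : nat) (xi : 'I_nx.+1 -> R).
Variables (v : @pwpoly R nx) (vL vR : 'rV[R]_5).
Hypothesis mesh : is_mesh xi.
Notation values := (data_values xi v vL vR).

Lemma cell_left (j : 'I_nx) : cell xi j (xi (ifl j)).
Proof. by rewrite /cell/= in_itv/= lexx ltW//; exact: mesh. Qed.

Lemma cell_right (j : 'I_nx) : cell xi j (xi (ifr j)).
Proof. by rewrite /cell/= in_itv/= lexx ltW//; exact: mesh. Qed.

Lemma trace_minus_values i : values (trace_minus xi v vL i).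
Proof.
rewrite /trace_minus; case: unliftP => [j ->|_]; last by right; left.
by left; exists j, (xi (ifr j)); split => //; exact: cell_right.
Qed.

Lemma trace_plus_values i : values (trace_plus xi v vR i).
Proof.
rewrite /trace_plus; case: unliftP => [j ->|_]; last by right; right.
by left; exists j, (xi (ifl j)); split => //; exact: cell_left.
Qed.

Lemma trace_minus_ifr j : trace_minus xi v vL (ifr j) = ev v j (xi (ifr j)).
Proof. by rewrite /trace_minus liftK. Qed.

Lemma trace_plus_ifl j : trace_plus xi v vR (ifl j) = ev v j (xi (ifl j)).
Proof. by rewrite /trace_plus liftK. Qed.

Hypothesis eq_data : moving_water_equilibrium xi v vL vR.

Lemma set_b_values w w' b : values w -> values w' -> set_b w b = set_b w' b.
Proof.
have [E1 [m1 [E2 [m2 eqw]]]] := eq_data.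
move=> /eqw[e0 e1 e2 e3] /eqw[e0' e1' e2' e3'].
by rewrite /set_b e0 e1 e2 e3 e0' e1' e2' e3'.
Qed.

Lemma fmod_equilibrium i : fmod g r D xi v vL vR i =
  2^-1 *: (flux g (inv_equil g r D (trace_minus xi v vL i))
           + flux g (inv_equil g r D (trace_plus xi v vR i))).
Proof.
have [E1 [m1 [E2 [m2 eqw]]]] := eq_data.
have Vm := trace_minus_values i; have Vp := trace_plus_values i.
have [_ e1 _ e3] := eqw _ Vm; have [_ e1' _ e3'] := eqw _ Vp.
rewrite /fmod /u_star (set_b_values _ Vm Vp) e1 e3 e1' e3'.
by rewrite subrr scaler0 subr0.
Qed.

Lemma gpath_equilibrium i : gpath g r D xi v vL vR i =
  flux g (inv_equil g r D (trace_minus xi v vL i))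
  - flux g (inv_equil g r D (trace_plus xi v vR i)).
Proof.
have Vm := trace_minus_values i; have Vp := trace_plus_values i.
have path_cst : path_tilde xi v vL vR i = cst (tilde (trace_minus xi v vL i)).
  apply/funext => t; rewrite /path_tilde /cst.
  (* [tilde] is [set_b] with bottom 0. *)
  by rewrite [X in X - _](set_b_values 0 Vp Vm) subrr scaler0 addr0.
rewrite /gpath path_cst (_ : \row_n _ = 0) ?add0r 1?addrC//.
apply/rowP => n; rewrite !mxE.
under eq_Rintegral => t _ do rewrite derive1_cst mul0mx mxE.
by rewrite Rintegral_cst// mul0r.
Qed.

End Interface.

Section Cell.
Context {R : realType}.
Variables (g r : R) (D : set 'rV[R]_5) (nx : nat) (xi : 'I_nx.+1 -> R).
Variables (v : @pwpoly R nx) (vL vR : 'rV[R]_5).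
Hypotheses (g_gt0 : 0 < g) (regimeD : flow_regime g r D).
Hypothesis mesh : is_mesh xi.
Hypothesis adm : admissible_data g r D xi v vL vR.
Hypothesis eq_data : moving_water_equilibrium xi v vL vR.

Notation state w := (inv_equil g r D w).

(** On the cell, f . phi is an antiderivative of f . phi_x - G u_x . phi, by the
    product rule and [is_derive_flux]. *)
Lemma cell_balance (j : 'I_nx) (phi : @pwpoly R nx) :
  \int[lebesgue_measure]_(x in cell xi j)
     dot (flux g (state (ev v j x))) (ev_x phi j x)
  - \int[lebesgue_measure]_(x in cell xi j)
     dot (u_x g r D (ev v j x) (ev_x v j x) *m (Gmx g r (state (ev v j x)))^T)
         (ev phi j x)
  = dot (flux g (state (ev v j (xi (ifr j))))) (ev phi j (xi (ifr j)))
  - dot (flux g (state (ev v j (xi (ifl j))))) (ev phi j (xi (ifl j))).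
Proof.
have [E1 [m1 [E2 [m2 eqw]]]] := eq_data.
have ab := mesh j.
have val x : x \in `[xi (ifl j), xi (ifr j)] ->
    data_values xi v vL vR (ev v j x).
  by move=> xI; left; exists j, x.
pose B := v j 0 4.
have [c0 c1 c2 c3] : [/\ v j 0 0 = E1%:P, v j 0 1 = m1%:P, v j 0 2 = E2%:P
                       & v j 0 3 = m2%:P].
  by split; apply: (poly_const_on_segment ab) => x /val/eqw[]; rewrite !mxE.
have evE x : ev v j x = vec5 E1 m1 E2 m2 B.[x].
  by apply: row5P; rewrite mxE vec5_coord ?c0 ?c1 ?c2 ?c3 ?hornerC.
have evxE x : ev_x v j x = vec5 0 0 0 0 B^`().[x].
  by apply: row5P; rewrite mxE vec5_coord ?c0 ?c1 ?c2 ?c3 ?derivC ?horner0.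
pose S b := state (vec5 E1 m1 E2 m2 b).
have im x : x \in `[xi (ifl j), xi (ifr j)] ->
    (equil g r @` D) (vec5 E1 m1 E2 m2 B.[x]).
  by rewrite -evE => /val/adm.
pose Gdu b := du g r (S b) *m (Gmx g r (S b))^T.
pose q x := B^`().[x] * dot (Gdu B.[x]) (ev phi j x).
have -> : \int[lebesgue_measure]_(x in cell xi j)
     dot (u_x g r D (ev v j x) (ev_x v j x) *m (Gmx g r (state (ev v j x)))^T)
         (ev phi j x) = \int[lebesgue_measure]_(x in cell xi j) q x.
  apply: eq_Rintegral => x; rewrite inE => /im imx; rewrite /q.
  rewrite evE evxE (_ : u_x _ _ _ _ _ = B^`().[x] *: du g r (S B.[x])).
    by rewrite -scalemxAl dotZl.
  rewrite /u_x !(dh_dv_bottom g_gt0 regimeD) // !vec5_coord /du.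
  by apply: row5P; rewrite [RHS]mxE !vec5_coord ?mulr0 ?mulr1// mulrC.
pose p x := dot (flux g (S B.[x])) (ev_x phi j x).
pose F x := dot (flux g (S B.[x])) (ev phi j x).
under eq_Rintegral => x _ do rewrite evE.
rewrite !evE -/(p _) -/(F _) -/(F (xi (ifl j))).
have dS x i : x \in `[xi (ifl j), xi (ifr j)] ->
   is_derive x 1 (fun x => flux g (S B.[x]) 0 i)
     (- Gdu B.[x] 0 i * B^`().[x]).
  move=> /im imx.
  have dB : is_derive x 1 (fun x => B.[x]) B^`().[x] by exact: is_derive_poly.
  exact: (is_derive1_comp (f := fun b => flux g (S b) 0 i)
            (is_derive_flux g_gt0 regimeD i imx) dB).
apply: Rintegral_derive_split => //.
- move=> x xI.
  have dterm i : is_derive x 1 (fun x => flux g (S B.[x]) 0 i * ev phi j x 0 i)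
     (flux g (S B.[x]) 0 i * ev_x phi j x 0 i
      - B^`().[x] * (Gdu B.[x] 0 i * ev phi j x 0 i)).
    have dphi : is_derive x 1 (fun x => ev phi j x 0 i) (ev_x phi j x 0 i).
      by rewrite mxE; under eq_fun do rewrite mxE; exact: is_derive_poly.
    apply: is_derive_eq (is_deriveM (dS x i xI) dphi) _.
    by rewrite /GRing.scale/=; ring.
  have -> : F = \sum_i (fun x => flux g (S B.[x]) 0 i * ev phi j x 0 i).
    by apply/funext => y; rewrite /F /dot fct_sumE.
  by apply: is_derive_eq (is_derive_sum dterm) _; rewrite sumrB -mulr_sumr.
- apply: continuous_in_subspaceT => x; rewrite inE => xI.
  apply: cvg_dot => i; last first.
    by rewrite mxE; under eq_fun do rewrite mxE; exact: continuous_horner.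
  have [Fx _] := dS x i xI.
  by apply: differentiable_continuous; exact/derivable1_diffP.
- apply: continuous_in_subspaceT => x; rewrite inE => xI.
  apply: cvgM; first exact: continuous_horner.
  apply: cvg_dot => i; last first.
    by rewrite mxE; under eq_fun do rewrite mxE; exact: continuous_horner.
  have imx := im x xI.
  have cS : S B.[y] @[y --> x] --> S B.[x].
    exact: (continuous_comp (@continuous_horner _ B x)
              (state_continuous g_gt0 regimeD imx)).
  have := Gdu_cvg g_gt0 regimeD (inv_equil_regime regimeD imx) cS.
  by move=> /(_ _) c; exact: (cvg_comp _ _ c (@coord_continuous _ _ _ 0 i _)).
Qed.

End Cell.

Theorem theorem4p1 (R : realType) (g r : R) (D : set 'rV[R]_5)
    (nx k : nat) (xi : 'I_nx.+1 -> R) (v : pwpoly nx) (vL vR : 'rV[R]_5)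
    (hg : 0 < g) (hr : 0 < r < 1)
    (hD : flow_regime g r D)
    (hxi : is_mesh xi)
    (hv : DGspace k v)
    (hadm : admissible_data g r D xi v vL vR)
    (heq : moving_water_equilibrium xi v vL vR) :
  forall (j : 'I_nx) (phi : pwpoly nx), DGspace k phi ->
    RHSM g r D xi v vL vR j phi = 0.
Proof.
move=> j phi _; rewrite /RHSM.
have := cell_balance hg hD hxi hadm heq j phi.
rewrite !fmod_equilibrium // !gpath_equilibrium //.
rewrite trace_minus_ifr trace_plus_ifl.
set P := \int[_]_(x in _) dot (flux _ _) _; set Q := \int[_]_(x in _) dot _ _.
move: (flux g _) (flux g _) (flux g _) (flux g _) => a1 a2 a3 a4.
move: (ev phi j _) (ev phi j _) => w1 w2.
move=> /eqP; rewrite subr_eq => /eqP ->.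
rewrite !(dotC _ (_ - _)) !dotZl !dotDl !dotNl.
by field.
Qed.
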